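(* For every set $S$ of $n$ points in $\mathbb{R}^3$, not all on a line, the number of triangles with vertices in $S$ whose area equals the minimum nonzero area among all triangles with vertices in $S$ is at most $n^2+O(n)$.
   Context: A triangle spanned by $S$ is an unordered triple of points of $S$; collinear triples (area $0$) are allowed but are not counted, and the minimum is over triangles of positive area. *)

(* Defs.v *)
From HB Require Import structures.
From mathcomp Require Import all_boot all_order all_algebra.
From mathcomp Require Import finmap ring.
From mathcomp Require Import reals.

Set Implicit Arguments.
Unset Strict Implicit.
Unset Printing Implicit Defensive.

Import Order.TTheory GRing.Theory Num.Theory.

Local Open Scope fset_scope.
Local Open Scope ring_scope.

(* The library norm `|u| on 'rV[R]_n is the sup norm, hence this one. *)
Definition enorm (R : realType) (u : 'rV[R]_3) : R :=
  Num.sqrt (\sum_(i < 3) u 0 i ^+ 2).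

(* The indices j + 1 and j + 2 are computed in 'I_3 = Z/3Z. *)
Definition cross (R : realType) (u v : 'rV[R]_3) : 'rV[R]_3 :=
  \row_(j < 3) (u 0 (j + 1) * v 0 (j + 2) - u 0 (j + 2) * v 0 (j + 1)).

Definition area (R : realType) (p q r : 'rV[R]_3) : R :=
  2^-1 * enorm (cross (q - p) (r - p)).

Definition on_a_line (R : realType) (S : {fset 'rV[R]_3}) : Prop :=
  exists p v : 'rV[R]_3, v != 0 /\
    forall x, x \in S -> exists t : R, x = p + t *: v.

Definition triangles (R : realType) (S : {fset 'rV[R]_3}) :
    {fset {fset 'rV[R]_3}} :=
  [fset T in fpowerset S | #|` T| == 3%N].

(* The order in which the three points are enumerated is irrelevant: see
   triangle_areaE. *)
Definition triangle_area (R : realType) (T : {fset 'rV[R]_3}) : R :=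
  let s := enum_fset T in area s`_0 s`_1 s`_2.

Definition min_area_triangles (R : realType) (S : {fset 'rV[R]_3}) :
    {fset {fset 'rV[R]_3}} :=
  [fset T in triangles S | (0 < triangle_area T) &&
     [forall T' : triangles S, (0 < triangle_area (val T')) ==>
        (triangle_area T <= triangle_area (val T'))]].

Lemma enormN (R : realType) (u : 'rV[R]_3) : enorm (- u) = enorm u.
Proof.
by congr Num.sqrt; apply: eq_bigr => i _; rewrite mxE sqrrN.
Qed.

Lemma area_swap12 (R : realType) (p q r : 'rV[R]_3) : area q p r = area p q r.
Proof.
rewrite /area -[in RHS]enormN; congr (_ * enorm _).
by apply/rowP => j; rewrite !mxE; ring.
Qed.

Lemma area_swap23 (R : realType) (p q r : 'rV[R]_3) : area p r q = area p q r.
Proof.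
rewrite /area -[in RHS]enormN; congr (_ * enorm _).
by apply/rowP => j; rewrite !mxE; ring.
Qed.

Lemma triangle_areaE (R : realType) (p q r : 'rV[R]_3) :
  uniq [:: p; q; r] -> triangle_area [fset p; q; r] = area p q r.
Proof.
move=> U; rewrite /triangle_area.
have := fset_uniq [fset p; q; r].
have : enum_fset [fset p; q; r] =i [:: p; q; r].
  by move=> x; rewrite !inE orbA.
move: (enum_fset _) => s sE Us.
have /perm_size sz := uniq_perm Us U sE.
case: s sz sE Us => [|a [|b [|c []]]] //= _ sE Us.
have [ha hb hc] : [/\ a \in [:: p; q; r], b \in [:: p; q; r]
    & c \in [:: p; q; r]] by rewrite -!sE !inE !eqxx !orbT.
move: ha hb hc Us; rewrite !inE.
move=> /or3P[]/eqP-> /or3P[]/eqP-> /or3P[]/eqP->; rewrite ?eqxx ?orbT ?andbF //= => _.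
- by rewrite area_swap23.
- by rewrite area_swap12.
- by rewrite area_swap23 area_swap12.
- by rewrite area_swap12 area_swap23.
- by rewrite area_swap12 area_swap23 area_swap12.
Qed.

(* Main.v *)
Require Import Defs.
From HB Require Import structures.
From mathcomp Require Import all_boot all_order all_algebra.
From mathcomp Require Import finmap.
From mathcomp Require Import ring lra zify.
From mathcomp Require Import reals.

Set Implicit Arguments.
Unset Strict Implicit.
Unset Printing Implicit Defensive.

Import Order.TTheory GRing.Theory Num.Theory.

Local Open Scope ring_scope.

(**
  Charge every minimum-area triangle abc to a longest side ab. Its apex c lies
  on a cylinder around ab whose radius is the altitude. If the altitude is small
  compared with |ab|, two apexes c, c' of ab must be almost opposite across the
  midpoint of ab, since otherwise acc' or bcc' is nondegenerate with smaller
  area; three points cannot be pairwise almost opposite, so ab has at most two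
  apexes. Such thin triangles number at most 2 * n(n-1)/2. All sides of a fat
  triangle are O(sqrt A), where A is the minimum area, and a ball of radius
  O(sqrt A) with noncollinear points of S contains O(1) points of S, because two
  very close points would force all the others onto their line; hence there are
  O(n) fat triangles.
*)

(** * Euclidean geometry through dot products *)

Definition dot (R : realType) (u v : 'rV[R]_3) : R := \sum_(i < 3) u 0 i * v 0 i.

(** By Lagrange's identity, the squared norm of the cross product. *)
Definition gram (R : realType) (u v : 'rV[R]_3) : R :=
  dot u u * dot v v - dot u v ^+ 2.

Definition sqdist (R : realType) (p q : 'rV[R]_3) : R := dot (q - p) (q - p).

(* Four times the squared area. *)
Definition sqarea (R : realType) (p q r : 'rV[R]_3) : R := gram (q - p) (r - p).

Lemma dotC (R : realType) (u v : 'rV[R]_3) : dot u v = dot v u.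
Proof. by apply: eq_bigr => i _; rewrite mulrC. Qed.

Lemma dotDl (R : realType) (u v w : 'rV[R]_3) : dot (u + v) w = dot u w + dot v w.
Proof. by rewrite -big_split; apply: eq_bigr => i _; rewrite mxE mulrDl. Qed.

Lemma dotZl (R : realType) (k : R) (u v : 'rV[R]_3) : dot (k *: u) v = k * dot u v.
Proof. by rewrite mulr_sumr; apply: eq_bigr => i _; rewrite mxE mulrA. Qed.

Lemma dotDr (R : realType) (u v w : 'rV[R]_3) : dot u (v + w) = dot u v + dot u w.
Proof. by rewrite !(dotC u) dotDl. Qed.

Lemma dotZr (R : realType) (k : R) (u v : 'rV[R]_3) : dot u (k *: v) = k * dot u v.
Proof. by rewrite !(dotC u) dotZl. Qed.

Lemma dotNl (R : realType) (u v : 'rV[R]_3) : dot (- u) v = - dot u v.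
Proof. by rewrite -scaleN1r dotZl mulN1r. Qed.

Lemma dotNr (R : realType) (u v : 'rV[R]_3) : dot u (- v) = - dot u v.
Proof. by rewrite !(dotC u) dotNl. Qed.

Definition dotE := (dotDl, dotDr, dotNl, dotNr, dotZl, dotZr).

Lemma dot_ge0 (R : realType) (u : 'rV[R]_3) : 0 <= dot u u.
Proof. by apply: sumr_ge0 => i _; rewrite -expr2 sqr_ge0. Qed.

Lemma dot_eq0 (R : realType) (u : 'rV[R]_3) : (dot u u == 0) = (u == 0).
Proof.
apply/eqP/eqP => [/eqP|->]; last by apply: big1 => i _; rewrite mxE mul0r.
rewrite psumr_eq0 => [|i _]; last by rewrite -expr2 sqr_ge0.
move=> /allP u0; apply/rowP => i; rewrite mxE.
by have := u0 i (mem_index_enum i); rewrite mulf_eq0 orbb => /eqP.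
Qed.

Lemma sqdistC (R : realType) (p q : 'rV[R]_3) : sqdist p q = sqdist q p.
Proof. by rewrite /sqdist !dotE; ring. Qed.

Lemma sqdist_ge0 (R : realType) (p q : 'rV[R]_3) : 0 <= sqdist p q.
Proof. exact: dot_ge0. Qed.

Lemma coord_sqdist (R : realType) (p q : 'rV[R]_3) (i : 'I_3) :
  (q 0 i - p 0 i) ^+ 2 <= sqdist p q.
Proof.
rewrite /sqdist /dot (bigD1 i) //= !mxE -expr2 lerDl.
by apply: sumr_ge0 => j _; rewrite -expr2 sqr_ge0.
Qed.

Lemma sqdist_lt (R : realType) (p q : 'rV[R]_3) (L : R) : 0 < L ->
  (forall i, `|q 0 i - p 0 i| < L) -> sqdist p q < 3 * L ^+ 2.
Proof.
move=> L0 pqL; have pqL2 i : (q - p) 0 i * (q - p) 0 i < L ^+ 2.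
  by rewrite !mxE -expr2 -real_normK ?num_real // ltr_pXn2r ?nnegrE ?normr_ge0 ?(ltW L0) ?pqL.
rewrite /sqdist /dot !big_ord_recr big_ord0 /= add0r.
by have := pqL2 (widen_ord (leqnSn 2) (widen_ord (leqnSn 1) ord_max));
  have := pqL2 (widen_ord (leqnSn 2) ord_max); have := pqL2 ord_max; lra.
Qed.

(* From |u + v|^2 + |u - v|^2 = 2 |u|^2 + 2 |v|^2, applied at the centre a. *)
Lemma sqdist_le4 (R : realType) (a p q : 'rV[R]_3) (d : R) :
  sqdist a p <= d -> sqdist a q <= d -> sqdist p q <= 4 * d.
Proof.
have := dot_ge0 ((p - a) + (q - a)).
by rewrite /sqdist !dotE !(dotC q) (dotC a p); lra.
Qed.

Lemma sqarea_le (R : realType) (p q r : 'rV[R]_3) :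
  sqarea p q r <= sqdist p q * sqdist p r.
Proof. by rewrite /sqarea /gram lerBlDr lerDl sqr_ge0. Qed.

Lemma sqarea_swap12 (R : realType) (p q r : 'rV[R]_3) :
  sqarea q p r = sqarea p q r.
Proof.
by rewrite /sqarea /gram !dotE (dotC q p) (dotC r p) (dotC r q); ring.
Qed.

Lemma sqarea_swap23 (R : realType) (p q r : 'rV[R]_3) :
  sqarea p r q = sqarea p q r.
Proof. by rewrite /sqarea /gram (dotC (r - p) (q - p)); ring. Qed.

Lemma sqareaE (R : realType) (p q r : 'rV[R]_3) :
  sqarea p q r = (2 * area p q r) ^+ 2.
Proof.
rewrite /area mulrA mulfV ?pnatr_eq0 // mul1r sqr_sqrtr; last first.
  by apply: sumr_ge0 => i _; rewrite sqr_ge0.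
rewrite /sqarea /gram /dot; move: (q - p) (r - p) => u v.
rewrite !big_ord_recr !big_ord0 /= !add0r !mxE.
set i0 := widen_ord (leqnSn 2) (widen_ord (leqnSn 1) ord_max).
set i1 := widen_ord (leqnSn 2) ord_max; set i2 : 'I_3 := ord_max.
have -> : i0 + 1 = i1 by exact: val_inj.
have -> : i0 + 2 = i2 by exact: val_inj.
have -> : i1 + 1 = i2 by exact: val_inj.
have -> : i1 + 2 = i0 by exact: val_inj.
have -> : i2 + 1 = i0 by exact: val_inj.
have -> : i2 + 2 = i1 by exact: val_inj.
by ring.
Qed.

Lemma sqarea_uniq (R : realType) (p q r : 'rV[R]_3) :
  sqarea p q r != 0 -> uniq [:: p; q; r].
Proof.
apply: contraR; rewrite /= !inE andbT negb_and !negbK.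
have aa x y : sqarea x x y = 0 :> R.
  by rewrite /sqarea /gram !dotE; ring.
case/orP => [/orP[]|] /eqP ->; rewrite ?aa //.
  by rewrite sqarea_swap23 aa.
by rewrite sqarea_swap12 sqarea_swap23 aa.
Qed.

(** Equality case of Cauchy-Schwarz: the part of [r - p] orthogonal to [q - p] has squared norm
    [sqarea p q r] divided by [|q - p|^2], and [t] is the projection coefficient. *)
Lemma sqarea_eq0_line (R : realType) (p q r : 'rV[R]_3) :
  p != q -> sqarea p q r = 0 -> exists t, r = p + t *: (q - p).
Proof.
move=> pq; rewrite /sqarea; set u := q - p; set v := r - p => g0.
have u0 : dot u u != 0 by rewrite dot_eq0 subr_eq0 eq_sym.
exists (dot u v / dot u u).
apply/eqP; rewrite addrC -subr_eq -/v -subr_eq0 -dot_eq0.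
clearbody u v; rewrite !dotE (dotC v u); move: g0; rewrite /gram => g0.
apply/eqP; have -> : dot v v = dot u v ^+ 2 / dot u u.
  by apply: (mulfI u0); rewrite -[LHS]subr0 -g0; field.
by field.
Qed.

Lemma sqarea_line (R : realType) (p u : 'rV[R]_3) (x y z : R) :
  sqarea (p + x *: u) (p + y *: u) (p + z *: u) = 0.
Proof.
have E s t : p + s *: u - (p + t *: u) = (s - t) *: u.
  by rewrite opprD addrACA subrr add0r scalerBl.
by rewrite /sqarea !E /gram !dotE; ring.
Qed.

(** * Points of a ball, counted by grid cells *)

(** Cells of mesh [L] for a ball of radius [24 L]: the floors of the scaled offsets range from -24
    to 24, both ends included. *)
Definition grid_size : nat := #|{: {ffun 'I_3 -> 'I_49}}|.

(** Pigeonhole: points sharing a cell differ by less than [L] in each coordinate, so separation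
    makes the cell map injective. *)
Lemma size_separated (R : realType) (a : 'rV[R]_3) (L : R)
    (X : seq 'rV[R]_3) : 0 < L -> uniq X ->
  (forall x, x \in X -> sqdist a x <= (24 * L) ^+ 2) ->
  (forall p q, p \in X -> q \in X -> sqdist p q < 3 * L ^+ 2 -> p = q) ->
  (size X <= grid_size)%N.
Proof.
move=> L0 UX XL sepX.
pose z (x : 'rV[R]_3) (i : 'I_3) : int := Num.floor ((x 0 i - a 0 i) / L) + 24.
pose cell x : {ffun 'I_3 -> 'I_49} := [ffun i => inord `|z x i|%N].
have zP x i : x \in X -> 0 <= z x i <= 48.
  move=> /XL /(le_trans (coord_sqdist a x i)).
  have L24 : 0 <= 24 * L by rewrite mulr_ge0 ?ltW.
  rewrite -[_ ^+ 2]real_normK ?num_real // ler_pXn2r ?nnegrE // => xL.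
  have : `|(x 0 i - a 0 i) / L| <= 24.
    rewrite normrM normfV ler_pdivrMr ?normr_gt0 ?gt_eqF //.
    by rewrite (gtr0_norm L0).
  rewrite ler_norml => /andP[lo hi]; rewrite /z.
  have lo' : (-24 : int) <= Num.floor ((x 0 i - a 0 i) / L).
    by rewrite floor_ge_int rmorphN.
  have hi' : Num.floor ((x 0 i - a 0 i) / L) <= (24 : int).
    rewrite -(ler_int R); apply: le_trans hi; exact: floor_le.
  by rewrite -lerBlDr sub0r lo' -lerBrDr.
rewrite -(size_map cell) /grid_size cardE; apply: uniq_leq_size; last first.
  by move=> c _; rewrite mem_enum.
rewrite map_inj_in_uniq // => p q pX qX epq; apply: sepX => //.
apply: sqdist_lt => // i.
have zpq : z p i = z q i.
  have := congr1 (fun f : {ffun 'I_3 -> 'I_49} => val (f i)) epq.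
  have := zP p i pX; have := zP q i qX; rewrite !ffunE /= => Hq Hp.
  by rewrite !inordK; [move: (z p i) (z q i) Hp Hq => f g; lia..].
move: zpq => /addIr; set x := (_ / L); set y := (_ / L) => fxy.
have -> : q 0 i - p 0 i = L * (y - x) by rewrite /x /y; field; rewrite gt_eqF.
rewrite normrM gtr0_norm // gtr_pMr // ltr_norml.
have := floor_itv x; have := floor_itv y; rewrite fxy intrD.
by move: (Num.floor y)%:~R => f; lra.
Qed.

(* The grid has mesh L with (24 L)^4 = 48 M, so that M = 3 L^2 * 4 (24 L)^2: two
   points in a cell and any third point of the ball span less than M. *)
Lemma size_sqarea_gap (R : realType) (a : 'rV[R]_3) (M : R)
    (X : seq 'rV[R]_3) : 0 < M -> uniq X ->
  (forall x, x \in X -> sqdist a x ^+ 2 <= 48 * M) ->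
  (forall p q r, p \in X -> q \in X -> r \in X ->
     sqarea p q r = 0 \/ M <= sqarea p q r) ->
  (exists p q r, [/\ p \in X, q \in X, r \in X & sqarea p q r != 0]) ->
  (size X <= grid_size)%N.
Proof.
move=> M0 UX XM gapX [x [y [z [xX yX zX xyz]]]].
pose r := Num.sqrt (Num.sqrt (48 * M)); pose L := r / 24.
have r0 : 0 < r by rewrite !sqrtr_gt0 mulr_gt0.
have r2 : r ^+ 2 = Num.sqrt (48 * M) by rewrite sqr_sqrtr ?sqrtr_ge0.
have r4 : (r ^+ 2) ^+ 2 = 48 * M by rewrite r2 sqr_sqrtr // mulr_ge0 // ltW.
have L0 : 0 < L by rewrite divr_gt0.
have rL : 24 * L = r by rewrite /L; field.
have XL t : t \in X -> sqdist a t <= (24 * L) ^+ 2.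
  move=> /XM; rewrite rL -r4 ler_pXn2r // nnegrE ?sqdist_ge0 //.
  by rewrite exprn_ge0 // ltW.
apply: (size_separated L0 UX XL) => p q pX qX pqL; apply/eqP.
apply: contraNT xyz => pq.
(* Distinct [p], [q] this close make every triangle [pqt] smaller than [M], hence degenerate by the
   gap, so all of [X] lies on the line [pq]. *)
have line t : t \in X -> exists s, t = p + s *: (q - p).
  move=> tX; apply: sqarea_eq0_line => //.
  have [//|] := gapX p q t pX qX tX; rewrite leNgt => /negP[].
  apply: le_lt_trans (sqarea_le p q t) _.
  have pt := sqdist_le4 (XL _ pX) (XL _ tX).
  apply: le_lt_trans (ler_wpM2l (sqdist_ge0 p q) pt) _.
  have L2 : 0 < L ^+ 2 by rewrite exprn_gt0.
  have -> : M = 3 * L ^+ 2 * (4 * (24 * L) ^+ 2).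
    have -> : M = (r ^+ 2) ^+ 2 / 48 by rewrite r4; field.
    by rewrite -rL; field.
  by rewrite ltr_pM2r // mulr_gt0 // exprn_gt0 // mulr_gt0.
have [s ->] := line x xX; have [t ->] := line y yX; have [v ->] := line z zX.
by rewrite sqarea_line.
Qed.

(** * Apexes on a cylinder *)

(* In units of |ab|, s and t are the positions of two apexes along the axis,
   e is the squared radius of the cylinder, and g is the cosine of the angle
   between the two apexes seen along the axis. *)
Lemma gram_cylinder (R : realType) (u w w' : 'rV[R]_3) (s t e g : R) :
  dot u w = 0 -> dot u w' = 0 ->
  dot w w = e * dot u u -> dot w' w' = e * dot u u ->
  dot w w' = e * dot u u * g ->
  gram (w + s *: u) (w' + t *: u) =
    dot u u ^+ 2 * e * (s ^+ 2 + t ^+ 2 - 2 * s * t * g + e * (1 - g ^+ 2)).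
Proof.
move=> uw uw' ww ww' wgw'; rewrite /gram !dotE !(dotC _ u) uw uw' ww ww' wgw'.
by ring.
Qed.

(** [(s + t)^2] is the assumed sum plus [2 s t (1 + g) + e g^2 - e], hence at least [1 - e], whereas
    [s + t < 1 - e] would put it below [(1 - e)^2 < 1 - e]. *)
Lemma cylinder_sum (R : realType) (s t e g : R) :
  0 < s < 1 -> 0 < t < 1 -> 0 < e -> e < 48^-1 -> -1 <= g <= 1 ->
  1 <= s ^+ 2 + t ^+ 2 - 2 * s * t * g + e * (1 - g ^+ 2) -> 1 - e <= s + t.
Proof.
move=> s01 t01 e0 e48 g1 H.
have H1 : 1 - e <= (s + t) ^+ 2.
  have : 0 <= s * t * (1 + g) by rewrite !mulr_ge0; lra.
  have : 0 <= e * g ^+ 2 by rewrite mulr_ge0 ?sqr_ge0 // ltW.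
  by lra.
rewrite leNgt; apply/negP => H2.
have : (s + t) * (s + t) <= (s + t) * (1 - e) by rewrite ler_wpM2l; lra.
by nra.
Qed.

(** For [g >= -1/2] the sum is at most [s^2 + t^2 + s t + e], which is below
    [3 (13/24)^2 + 1/48 = 519/576]. *)
Lemma cylinder_close (R : realType) (s t e g : R) :
  0 < s <= 13 / 24 -> 0 < t <= 13 / 24 -> 0 < e -> e < 48^-1 -> - 2^-1 <= g ->
  s ^+ 2 + t ^+ 2 - 2 * s * t * g + e * (1 - g ^+ 2) < 1.
Proof.
move=> sP tP e0 e48 gP.
have : s * t <= 13 / 24 * (13 / 24) by rewrite ler_pM; lra.
have : s * s <= 13 / 24 * (13 / 24) by rewrite ler_pM; lra.
have : t * t <= 13 / 24 * (13 / 24) by rewrite ler_pM; lra.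
have : 0 <= s * t * (2^-1 + g) by rewrite !mulr_ge0; lra.
have : 0 <= e * g ^+ 2 by rewrite mulr_ge0 ?sqr_ge0 // ltW.
by lra.
Qed.

(** The bounds at both ends keep every [t] near 1/2, which forces each pairwise cosine below -1/2.
    But [3 + 2 (g12 + g13 + g23)] is the squared length of a sum of three unit vectors. *)
Lemma three_on_cylinder (R : realType) (t1 t2 t3 e g12 g13 g23 : R) :
  let Q s t g := s ^+ 2 + t ^+ 2 - 2 * s * t * g + e * (1 - g ^+ 2) in
  0 < e -> e < 48^-1 -> 0 < t1 < 1 -> 0 < t2 < 1 -> 0 < t3 < 1 ->
  -1 <= g12 <= 1 -> -1 <= g13 <= 1 -> -1 <= g23 <= 1 ->
  0 <= 3 + 2 * (g12 + g13 + g23) ->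
  1 <= Q t1 t2 g12 -> 1 <= Q (1 - t1) (1 - t2) g12 ->
  1 <= Q t1 t3 g13 -> 1 <= Q (1 - t1) (1 - t3) g13 ->
  1 <= Q t2 t3 g23 -> 1 <= Q (1 - t2) (1 - t3) g23 -> False.
Proof.
move=> Q e0 e48 t1P t2P t3P g12P g13P g23P G Q12 R12 Q13 R13 Q23 R23.
have L12 := cylinder_sum t1P t2P e0 e48 g12P Q12.
have L13 := cylinder_sum t1P t3P e0 e48 g13P Q13.
have L23 := cylinder_sum t2P t3P e0 e48 g23P Q23.
have s1P : 0 < 1 - t1 < 1 by lra.
have s2P : 0 < 1 - t2 < 1 by lra.
have s3P : 0 < 1 - t3 < 1 by lra.
have U12 := cylinder_sum s1P s2P e0 e48 g12P R12.
have U13 := cylinder_sum s1P s3P e0 e48 g13P R13.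
have U23 := cylinder_sum s2P s3P e0 e48 g23P R23.
(* Sums of two [t] lie in [[1 - e, 1 + e]], so [2 t1 = (t1 + t2) + (t1 + t3) - (t2 + t3) <= 1 + 3
   e], and [(1 + 3 e) / 2 < 17/32 < 13/24]. *)
have [T1 T2 T3] : [/\ 0 < t1 <= 13 / 24, 0 < t2 <= 13 / 24 & 0 < t3 <= 13 / 24].
  by clear -e48 L12 L13 L23 U12 U13 U23 t1P t2P t3P; split; lra.
have close s t g : 0 < s <= 13 / 24 -> 0 < t <= 13 / 24 -> 1 <= Q s t g ->
    g < - 2^-1.
  by move=> sP tP; case: (ltP g) => // gP; rewrite leNgt cylinder_close.
have := close _ _ _ T1 T2 Q12; have := close _ _ _ T1 T3 Q13.
have := close _ _ _ T2 T3 Q23.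
by clear -G; lra.
Qed.

(** The form is a sum of nonnegative terms [(s - t)^2], [2 s t (1 - g)] and [e (1 - g) (1 + g)]. *)
Lemma cylinder_eq0 (R : realType) (s t e g : R) :
  0 < s -> 0 < t -> 0 < e -> -1 <= g <= 1 ->
  s ^+ 2 + t ^+ 2 - 2 * s * t * g + e * (1 - g ^+ 2) = 0 -> s = t /\ g = 1.
Proof.
move=> s0 t0 e0 /andP[g1 g2] Q0.
have st : 0 < s * t by rewrite mulr_gt0.
have H1 : 0 <= (s - t) ^+ 2 by rewrite sqr_ge0.
have H2 : 0 <= s * t * (1 - g) by rewrite mulr_ge0 ?subr_ge0 // ltW.
have H3 : 0 <= e * ((1 - g) * (1 + g)) by rewrite !mulr_ge0; lra.
have Z1 : (s - t) ^+ 2 == 0 by apply/eqP; lra.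
have Z2 : s * t * (1 - g) == 0 by apply/eqP; lra.
move: Z1 Z2; rewrite sqrf_eq0 subr_eq0 mulf_eq0 (gt_eqF st) /= subr_eq0.
by move=> /eqP -> /eqP ->.
Qed.

(** [ab] is a longest side, ties allowed; [M] is a value of [sqarea]. *)
Definition apex (R : realType) (M : R) (a b c : 'rV[R]_3) : bool :=
  [&& sqarea a b c == M, sqdist a c <= sqdist a b & sqdist b c <= sqdist a b].

(** Splitting each [c - a] along and across [ab] turns the gaps at [a] and [b] into the inequalities
    refuted by [three_on_cylinder]. *)
Lemma three_apexes (R : realType) (M : R) (a b c1 c2 c3 : 'rV[R]_3) :
  let X := [:: c1; c2; c3] in
  0 < M -> uniq X -> 48 * M < sqdist a b ^+ 2 ->
  {in X, forall c, apex M a b c} ->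
  {in X &, forall c c', sqarea a c c' = 0 \/ M <= sqarea a c c'} ->
  {in X &, forall c c', sqarea b c c' = 0 \/ M <= sqarea b c c'} -> False.
Proof.
move=> X M0 UX Mab apX gapa gapb.
have [u uE] : {u | u = b - a} by exists (b - a).
set D := dot u u.
have D0 : 0 < D.
  rewrite lt_neqAle dot_ge0 andbT eq_sym; apply: contraTneq Mab => D0.
  by rewrite /sqdist -uE -/D D0 -leNgt expr0n /= mulr_ge0 // ltW.
have D2 : 0 < D ^+ 2 by rewrite exprn_gt0.
have Dn0 : D != 0 by rewrite gt_eqF.
(* [M] is [D] times the squared altitude, which is thus [e * D]. *)
pose e := M / D ^+ 2.
have e0 : 0 < e by rewrite divr_gt0.
have e48 : e < 48^-1.
  move: Mab; rewrite /sqdist -uE -/D => Mab.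
  by rewrite ltr_pdivrMr // mulrC ltr_pdivlMr // mulrC.
have DM : D ^+ 2 * e = M by rewrite /e mulrC divfK // gt_eqF.
pose t c := dot u (c - a) / D; pose w c := c - a - t c *: u.
have uw c : dot u (w c) = 0.
  by rewrite /w dotDr dotNr dotZr -/D /t divfK // subrr.
have ca c : c - a = w c + t c *: u by rewrite /w subrK.
have cb c : c - b = w c + (t c - 1) *: u.
  by rewrite scalerBl scale1r addrA -ca uE opprB addrA subrK.
clearbody w.
have ww c : c \in X -> dot (w c) (w c) = e * D.
  move=> /apX /and3P[/eqP + _ _]; rewrite /sqarea -uE ca /gram -/D !dotE.
  rewrite !(dotC _ u) uw -/D => ME; apply: (mulfI Dn0).
  by rewrite -[RHS](_ : M = _); [rewrite -ME; ring | rewrite -DM; ring].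
(* As [ab] is a longest side, [t^2 + e <= 1] and [(1 - t)^2 + e <= 1]. *)
have t01 c : c \in X -> 0 < t c < 1.
  move=> cX; have /and3P[_] := apX c cX; rewrite /sqdist ca cb -uE -/D !dotE.
  rewrite !(dotC _ u) uw -/D ww // => Ha Hb.
  have Ha' : t c ^+ 2 <= 1 - e by rewrite -(ler_pM2r D0); lra.
  have Hb' : (t c - 1) ^+ 2 <= 1 - e by rewrite -(ler_pM2r D0); lra.
  by apply/andP; split; nra.
pose g c c' := dot (w c) (w c') / (e * D).
have eD : 0 < e * D by rewrite mulr_gt0.
have wgw c c' : dot (w c) (w c') = e * D * g c c'.
  by rewrite /g mulrC divfK // gt_eqF.
have g1 c c' : c \in X -> c' \in X -> -1 <= g c c' <= 1.
  move=> cX cX'; have := dot_ge0 (w c + w c'); have := dot_ge0 (w c - w c').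
  rewrite !dotE !(dotC (w c') (w c)) !ww // wgw => H1 H2.
  apply/andP; split; rewrite -(ler_pM2l eD); lra.
pose Q s t g : R := s ^+ 2 + t ^+ 2 - 2 * s * t * g + e * (1 - g ^+ 2).
have apart c c' : c \in X -> c' \in X -> t c = t c' -> g c c' = 1 -> c = c'.
  move=> cX cX' tt gg; apply: (addIr (- a)); rewrite !ca tt; congr (_ + _).
  apply/eqP; rewrite -subr_eq0 -dot_eq0 !dotE (dotC (w c') (w c)) !ww // wgw gg.
  by apply/eqP; ring.
have QP c c' : c \in X -> c' \in X -> c != c' ->
    1 <= Q (t c) (t c') (g c c') /\ 1 <= Q (1 - t c) (1 - t c') (g c c').
  move=> cX cX' cc'; have /andP[tc tc1] := t01 c cX.
  have /andP[tc' tc1'] := t01 c' cX'.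
  have aE : sqarea a c c' = M * Q (t c) (t c') (g c c').
    rewrite /sqarea !ca (gram_cylinder _ _ (uw c) (uw c') (ww c cX) (ww c' cX')
      (wgw c c')).
    by rewrite DM.
  (* Seen from [b] the axial coordinate is [t c - 1]; [Q] is unchanged when both coordinates change
     sign. *)
  have bE : sqarea b c c' = M * Q (1 - t c) (1 - t c') (g c c').
    rewrite /sqarea !cb (gram_cylinder _ _ (uw c) (uw c') (ww c cX) (ww c' cX')
      (wgw c c')).
    by rewrite -/D DM /Q; ring.
  split.
    (* A degenerate triangle [a c c'] would force [c = c']. *)
    case: (gapa c c' cX cX'); rewrite aE; last by rewrite -{1}[M]mulr1 ler_pM2l.
    move=> /eqP; rewrite mulf_eq0 (gt_eqF M0) /= => /eqP Q0.
    have [tt gg] := cylinder_eq0 tc tc' e0 (g1 c c' cX cX') Q0.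
    by rewrite (apart c c') ?eqxx in cc'.
  case: (gapb c c' cX cX'); rewrite bE; last by rewrite -{1}[M]mulr1 ler_pM2l.
  move=> /eqP; rewrite mulf_eq0 (gt_eqF M0) /= => /eqP Q0.
  have [||tt gg] := cylinder_eq0 _ _ e0 (g1 c c' cX cX') Q0; rewrite ?subr_gt0 //.
  by rewrite (apart c c') ?eqxx // in cc'; lra.
have [X1 X2 X3] : [/\ c1 \in X, c2 \in X & c3 \in X].
  by rewrite !inE !eqxx !orbT.
move: UX; rewrite /= !inE negb_or andbT => /andP[/andP[c12 c13] c23].
have [Q12 R12] := QP _ _ X1 X2 c12; have [Q13 R13] := QP _ _ X1 X3 c13.
have [Q23 R23] := QP _ _ X2 X3 c23.
apply: (three_on_cylinder e0 e48 (t01 _ X1) (t01 _ X2) (t01 _ X3)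
  (g1 _ _ X1 X2) (g1 _ _ X1 X3) (g1 _ _ X2 X3) _ Q12 R12 Q13 R13 Q23 R23).
(* Dividing by [e * D] gives the remaining condition on the cosines. *)
have := dot_ge0 (w c1 + w c2 + w c3); rewrite !dotE.
rewrite (dotC (w c2) (w c1)) (dotC (w c3) (w c1)) (dotC (w c3) (w c2)).
rewrite !ww // !wgw.
by move=> H; rewrite -(ler_pM2l eD); lra.
Qed.

Lemma count_apexes (R : realType) (M : R) (X : seq 'rV[R]_3) (a b : 'rV[R]_3) :
  0 < M -> uniq X -> a \in X -> b \in X -> 48 * M < sqdist a b ^+ 2 ->
  (forall p q r, p \in X -> q \in X -> r \in X ->
     sqarea p q r = 0 \/ M <= sqarea p q r) ->
  (count (apex M a b) X <= 2)%N.
Proof.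
move=> M0 UX aX bX Mab gapX; rewrite leqNgt; apply/negP; rewrite -size_filter.
have := filter_uniq (apex M a b) UX.
have : {in filter (apex M a b) X, forall c, (c \in X) && apex M a b c}.
  by move=> c; rewrite mem_filter andbC.
case: filter => [|c1 [|c2 [|c3 s]]] //= sub U _.
have sub3 : {subset [:: c1; c2; c3] <= [:: c1, c2, c3 & s]}.
  by move=> x; rewrite !inE => /or3P[] ->; rewrite ?orbT.
apply: (@three_apexes R M a b c1 c2 c3) => //.
- by move: U; rewrite /= !inE !negb_or => /and4P[/and3P[-> -> _] /andP[-> _]].
- by move=> c /sub3/sub/andP[].
- by move=> c c' /sub3/sub/andP[cX _] /sub3/sub/andP[cX' _]; apply: gapX.
- by move=> c c' /sub3/sub/andP[cX _] /sub3/sub/andP[cX' _]; apply: gapX.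
Qed.

(** * Comparison of areas and choice of a longest side *)

Lemma area_ge0 (R : realType) (p q r : 'rV[R]_3) : 0 <= area p q r.
Proof. by rewrite mulr_ge0 ?invr_ge0 // sqrtr_ge0. Qed.

Lemma ler_sqarea (R : realType) (p q r p' q' r' : 'rV[R]_3) :
  (sqarea p q r <= sqarea p' q' r') = (area p q r <= area p' q' r').
Proof.
rewrite !sqareaE; move: (area_ge0 p q r) (area_ge0 p' q' r').
move: (area p q r) (area p' q' r') => x y x0 y0.
by rewrite !exprMn ler_pM2l ?exprn_gt0 // ler_pXn2r.
Qed.

Lemma apexC (R : realType) (M : R) (a b c : 'rV[R]_3) :
  apex M b a c = apex M a b c.
Proof. by rewrite /apex sqarea_swap12 (sqdistC b a) [X in _ && X]andbC. Qed.

Lemma exists_apex (R : realType) (M : R) (p q r : 'rV[R]_3) :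
  sqarea p q r = M ->
  exists a b c, [fset p; q; r]%fset = [fset a; b; c]%fset /\ apex M a b c.
Proof.
move=> pqrM; rewrite /apex; pose x := sqdist p q; pose y := sqdist p r.
have [yx|/ltW xy] := lerP y x;
  have [zx|/ltW xz] := lerP (sqdist q r) (Num.max x y).
- exists p, q, r; split=> //; rewrite pqrM eqxx /= -/x -/y yx /=.
  by rewrite max_l in zx.
- exists q, r, p; split; first by apply/fsetP => t; rewrite !inE; do !case: eqP.
  rewrite sqarea_swap23 sqarea_swap12 pqrM eqxx /= (sqdistC q p) (sqdistC r p).
  by rewrite -/x -/y !(le_trans _ xz) // le_max lexx ?orbT.
- exists p, r, q; split; first by apply/fsetP => t; rewrite !inE; do !case: eqP.
  rewrite sqarea_swap23 pqrM eqxx /= (sqdistC r q) -/x -/y xy /=.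
  by rewrite max_r in zx.
- exists q, r, p; split; first by apply/fsetP => t; rewrite !inE; do !case: eqP.
  rewrite sqarea_swap23 sqarea_swap12 pqrM eqxx /= (sqdistC q p) (sqdistC r p).
  by rewrite -/x -/y !(le_trans _ xz) // le_max lexx ?orbT.
Qed.

(** * Counting thin and fat triangles *)

(** Double counting of pairs with [f x = y]: each [x] meets at most one [y], since [F] has no
    repetition. *)
Lemma leq_size_fibers (I J : eqType) (f : I -> J) (A : seq I) (F : seq J)
    (k : nat) : uniq F ->
  (forall y, y \in F -> k <= count (fun x => f x == y) A)%N ->
  (k * size F <= size A)%N.
Proof.
move=> UF kF; apply: (@leq_trans (\sum_(y <- F) count (fun x => f x == y) A)).
  rewrite -sum1_size big_distrr /= big_seq [leqRHS]big_seq.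
  by apply: leq_sum => y yF; rewrite muln1 kF.
under eq_bigr do rewrite -sum1_count big_mkcond.
rewrite exchange_big -sum1_size /=; apply: leq_sum => x _.
rewrite -big_mkcond sum1_count (eq_count (a2 := pred1 (f x))) => [|y]; last first.
  by rewrite /= eq_sym.
by rewrite count_uniq_mem //; case: (_ \in _).
Qed.

Lemma leq_size_allpairs_dep (I J : eqType) (A : seq I) (t : I -> seq J)
    (k : nat) : (forall x, x \in A -> size (t x) <= k)%N ->
  (size [seq (x, y) | x <- A, y <- t x] <= k * size A)%N.
Proof.
rewrite size_allpairs_dep; elim: A => [|x A IH] //= kA.
rewrite mulnS leq_add ?kA ?mem_head // IH // => y yA.
by rewrite kA // inE yA orbT.
Qed.

Lemma count_ge2 (I : eqType) (P : pred I) (A : seq I) (x y : I) :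
  x != y -> x \in A -> y \in A -> P x -> P y -> (1 < count P A)%N.
Proof.
move=> xy xA yA Px Py; rewrite -size_filter.
apply: (@uniq_leq_size _ [:: x; y]) => [|z]; first by rewrite /= inE xy.
by rewrite !inE => /orP[]/eqP->; rewrite mem_filter ?Px ?Py.
Qed.

(** An ordered pair has at most two thin apexes, and each thin triangle is listed for both orders of
    its long side, so the factors 2 cancel. A fat triangle is given by a vertex and two points of
    the ball around it. *)
Lemma size_apex_triangles (R : realType) (M : R) (X : seq 'rV[R]_3)
    (F : seq {fset 'rV[R]_3}) : 0 < M -> uniq X ->
  (forall p q r, p \in X -> q \in X -> r \in X ->
     sqarea p q r = 0 \/ M <= sqarea p q r) ->
  uniq F ->
  (forall T, T \in F -> exists a b c,
     [/\ a \in X, b \in X, c \in X, T = [fset a; b; c]%fset & apex M a b c]) ->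
  (size F <= size X ^ 2 + grid_size ^ 2 * size X)%N.
Proof.
move=> M0 UX gapX UF FX.
pose ball a := [seq x <- X | sqdist a x ^+ 2 <= 48 * M].
(* The empty default makes the size bound unconditional; for the triangles at hand [near a] is the
   whole ball. *)
pose near a := if (size (ball a) <= grid_size)%N then ball a else [::].
pose Afat := [seq (a, bc) | a <- X, bc <- [seq (b, c) | b <- near a, c <- near a]].
pose thin ab c := (48 * M < sqdist ab.1 ab.2 ^+ 2) && apex M ab.1 ab.2 c.
pose Athin := [seq (ab, c) | ab <- [seq (a, b) | a <- X, b <- X],
                             c <- [seq c <- X | thin ab c]].
pose tri (x : 'rV[R]_3 * ('rV[R]_3 * 'rV[R]_3)) := [fset x.1; x.2.1; x.2.2]%fset.
pose tri' (x : 'rV[R]_3 * 'rV[R]_3 * 'rV[R]_3) := [fset x.1.1; x.1.2; x.2]%fset.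
have szfat : (size Afat <= grid_size ^ 2 * size X)%N.
  apply: leq_size_allpairs_dep => a _.
  have sz : (size (near a) <= grid_size)%N by rewrite /near; case: ifP.
  by rewrite size_allpairs -mulnn leq_mul.
have szthin : (size Athin <= 2 * size X ^ 2)%N.
  rewrite -mulnn -(size_allpairs pair X X).
  apply: leq_size_allpairs_dep => ab.
  move=> /allpairsP[[a b] [/= aX bX ->]]; rewrite size_filter /thin /=.
  have [Mab|_] := boolP (48 * M < _); last by rewrite count_pred0.
  exact: count_apexes.
(* Fat means listed in [Afat]; a long side is derived for all other triangles. *)
pose isfat T := T \in [seq tri x | x <- Afat].
have Ffat : (count isfat F <= size Afat)%N.
  rewrite -size_filter -(size_map tri).
  apply: uniq_leq_size; first exact: filter_uniq.
  by move=> T; rewrite mem_filter => /andP[].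
have Fthin : (2 * count (predC isfat) F <= size Athin)%N.
  rewrite -size_filter; apply: (leq_size_fibers (f := tri')) => [|T].
    exact: filter_uniq.
  rewrite mem_filter => /andP[/= Tthin /FX[a [b [c [aX bX cX TE abc]]]]].
  have /and3P[/eqP abM ac bc] := abc.
  have U : uniq [:: a; b; c] by apply: sqarea_uniq; rewrite abM gt_eqF.
  (* Were [ab] short, the ball about [a] would contain the noncollinear [a], [b], [c], hence have at
     most [grid_size] points, and [T] would be fat. *)
  have Mab : 48 * M < sqdist a b ^+ 2.
    rewrite ltNge; apply: contra Tthin => abM'.
    have aball : a \in ball a.
      rewrite mem_filter aX andbT /sqdist subrr.
      rewrite (eqP (_ : dot 0 0 == 0)) ?dot_eq0 //.
      by rewrite expr0n mulr_ge0 // ltW.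
    have bball : b \in ball a by rewrite mem_filter abM'.
    have cball : c \in ball a.
      rewrite mem_filter cX andbT; apply: le_trans abM'.
      by rewrite ler_pXn2r ?nnegrE ?sqdist_ge0.
    have nearE : near a = ball a.
      rewrite /near (@size_sqarea_gap R a M) //.
      - exact: filter_uniq.
      - by move=> x; rewrite mem_filter => /andP[].
      - move=> p q r; rewrite !mem_filter => /andP[_ ?] /andP[_ ?] /andP[_ ?].
        exact: gapX.
      - by exists a, b, c; rewrite abM gt_eqF.
    apply/mapP; exists (a, (b, c)) => //.
    apply/allpairsPdep; exists a, (b, c); split=> //.
    by apply/allpairsP; exists (b, c); rewrite /= nearE.
  have in_thin p q : p \in X -> q \in X -> thin (p, q) c -> (p, q, c) \in Athin.
    move=> pX qX pqc; apply/allpairsPdep; exists (p, q), c; split=> //.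
      by apply/allpairsP; exists (p, q).
    by rewrite mem_filter pqc.
  apply: (@count_ge2 _ _ _ (a, b, c) (b, a, c)).
  - by move: U; rewrite /= !xpair_eqE !inE negb_or !andbT => /andP[/andP[/negPf->]].
  - by rewrite in_thin // /thin Mab.
  - by rewrite in_thin // /thin /= sqdistC Mab apexC.
  - by rewrite TE.
  - by rewrite TE /tri' /= (fsetUC [fset b]%fset).
rewrite -(count_predC isfat F) addnC leq_add //; last exact: leq_trans szfat.
by rewrite -(leq_pmul2l (ltn0Sn 1)) (leq_trans Fthin).
Qed.

(** * From minimum-area sets to triples of points *)

Lemma card_fset3 (K : choiceType) (p q r : K) :
  uniq [:: p; q; r] -> #|` [fset p; q; r]|%fset = 3.
Proof.
move=> U; apply/esym; rewrite -[LHS]/(size [:: p; q; r]).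
apply/perm_size/uniq_perm => // x.
by rewrite !inE orbA.
Qed.

Lemma fset_card3 (K : choiceType) (T : {fset K}) : #|` T|%fset = 3 ->
  exists p q r, uniq [:: p; q; r] /\ T = [fset p; q; r]%fset.
Proof.
have U := fset_uniq T; have TE x : (x \in T) = (x \in enum_fset T) by [].
case: (enum_fset T) U TE => [|p [|q [|r []]]] // U TE _.
by exists p, q, r; split=> //; apply/fsetP => x; rewrite TE !inE orbA.
Qed.

(** The case [sqarea x y z = 0] absorbs collinear and repeated points, so minimality applies to
    arbitrary triples, as the gap hypotheses require. *)
Lemma min_area_trianglesP (R : realType) (S T : {fset 'rV[R]_3}) :
  T \in min_area_triangles S -> exists p q r,
    [/\ p \in S, q \in S, r \in S, T = [fset p; q; r]%fset
      & 0 < area p q r /\ forall x y z, x \in S -> y \in S -> z \in S ->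
          sqarea x y z = 0 \/ area p q r <= area x y z].
Proof.
rewrite !inE /= => /andP[/andP[TS /eqP T3] /andP[T0 /forallP Tmin]].
have [p [q [r [U TE]]]] := fset_card3 T3.
move: TS T0 Tmin; rewrite fpowersetE {}TE triangle_areaE // => /fsubsetP TS T0 Tmin.
exists p, q, r; split; rewrite ?TS ?inE ?eqxx ?orbT //; split=> // x y z xS yS zS.
have [|xyz] := eqVneq (sqarea x y z) 0; [by left | right].
have xyzU := sqarea_uniq xyz.
have xyzT : [fset x; y; z]%fset \in triangles S.
  rewrite !inE /= fpowersetE card_fset3 // eqxx andbT.
  by apply/fsubsetP => t; rewrite !inE => /orP[/orP[]|]/eqP->.
have /implyP := Tmin [` xyzT]%fset; rewrite /= triangle_areaE //; apply.
rewrite lt_neqAle eq_sym; apply/andP; split.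
  by apply: contraNneq xyz; rewrite sqareaE => ->; rewrite mulr0 expr0n.
exact: area_ge0.
Qed.

Local Close Scope ring_scope.

Theorem theorem8 (R : realType) :
  exists C : nat, forall (n : nat) (S : {fset 'rV[R]_3}),
    #|` S|%fset = n -> ~ on_a_line S ->
    #|` min_area_triangles S|%fset <= n ^ 2 + C * n.
Proof.
exists (grid_size ^ 2) => n S <- _.
have [->|[T0 T0min]] := fset_0Vmem (min_area_triangles S).
  by rewrite cardfs0.
have [p [q [r [pS qS rS _ [pqr0 pqrmin]]]]] := min_area_trianglesP T0min.
have M0 : (0 < sqarea p q r)%R by rewrite sqareaE exprn_gt0 // mulr_gt0.
apply: (@size_apex_triangles R _ (enum_fset S) _ M0); rewrite ?fset_uniq //.
  move=> x y z xS yS zS; have [|] := pqrmin x y z xS yS zS.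
    by left.
  by right; rewrite ler_sqarea.
move=> T /min_area_trianglesP[x [y [z [xS yS zS -> [xyz0 xyzmin]]]]].
(* Two minimum triangles bound each other's area. *)
have xyzM : sqarea x y z = sqarea p q r.
  apply/eqP; rewrite eq_le; rewrite !ler_sqarea; apply/andP; split.
    have [pqr|//] := xyzmin p q r pS qS rS.
    by rewrite pqr ltxx in M0.
  have [xyz|//] := pqrmin x y z xS yS zS.
  move: xyz; rewrite sqareaE => /eqP; rewrite sqrf_eq0 mulf_eq0.
  by rewrite (gt_eqF xyz0) orbF pnatr_eq0.
have [a [b [c [E abc]]]] := exists_apex xyzM; exists a, b, c; rewrite E.
have abcS t : t \in [fset a; b; c]%fset -> t \in S.
  by rewrite -E !inE => /orP[/orP[]|]/eqP->.
by split; rewrite ?abcS ?inE ?eqxx ?orbT.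
Qed.
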